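(* Let $p$ be a prime, let $q\in\mathbb{C}_p$ with $|1-q|_p<1$, let $r\in\mathbb{N}$, $n\ge0$, $x\in\mathbb{Z}_p$, and let $w_1,w_2\in\mathbb{N}$ with $w_1\equiv 1 \pmod 2$ and $w_2\equiv 1\pmod 2$. Then \begin{align*} &[w_1]_q^n\sum_{j_1,\dots,j_r=0}^{w_1-1}(-1)^{\sum_{l=1}^r j_l}E^{(r)}_{n,q^{w_1}}\!\left(w_2x+\tfrac{w_2}{w_1}(j_1+\cdots+j_r)\right)\\ =&[w_2]_q^n\sum_{j_1,\dots,j_r=0}^{w_2-1}(-1)^{\sum_{l=1}^r j_l}E^{(r)}_{n,q^{w_2}}\!\left(w_1x+\tfrac{w_1}{w_2}(j_1+\cdots+j_r)\right). \end{align*}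
   Context: $\mathbb{Z}_p$, $\mathbb{C}_p$ denote the $p$-adic integers and the completion of an algebraic closure of $\mathbb{Q}_p$. For $q\in\mathbb{C}_p$ with $|1-q|_p<1$, $[z]_q=\frac{1-q^z}{1-q}$. For continuous $f:\mathbb{Z}_p\to\mathbb{C}_p$, the fermionic $p$-adic integral is $\int_{\mathbb{Z}_p}f(y)\,d\mu_{-1}(y)=\lim_{N\to\infty}\sum_{y=0}^{p^N-1}f(y)(-1)^y$. The $q$-Euler polynomials of order $r$ are $E^{(r)}_{n,q}(z)=\int_{\mathbb{Z}_p}\cdots\int_{\mathbb{Z}_p}[z+y_1+\cdots+y_r]_q^n\,d\mu_{-1}(y_1)\cdots d\mu_{-1}(y_r)$ (equivalently, $\sum_{n\ge0}E^{(r)}_{n,q}(z)\frac{t^n}{n!}=2^r\sum_{m_1,\dots,m_r\ge0}(-1)^{m_1+\cdots+m_r}e^{[m_1+\cdots+m_r+z]_qt}$). In $E^{(r)}_{n,q^{w_1}}(w_2x+\frac{w_2}{w_1}J)$ with $J=j_1+\cdots+j_r$, the quantity $[w_2x+\frac{w_2}{w_1}J+Y]_{q^{w_1}}$ is understood as $\frac{1-q^{w_1w_2x+w_2J+w_1Y}}{1-q^{w_1}}$; similarly with $w_1,w_2$ interchanged.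
   Formalization: It is additionally assumed that 1-q^{w_1} and 1-q^{w_2} are nonzero (so q≠1): otherwise, e.g. for q=1, or for q a primitive p-th root of unity with p odd and w_1=p, the denominators in the q-numbers vanish and the expressions are undefined. *)

(* Defs.v *)
From HB Require Import structures.
From mathcomp Require Import all_boot all_order all_algebra.
From mathcomp Require Import all_classical all_reals topology normedtype.

Set Implicit Arguments.
Unset Strict Implicit.
Unset Printing Implicit Defensive.

Import Order.TTheory GRing.Theory Num.Theory.
Import numFieldNormedType.Exports.

Local Open Scope classical_set_scope.
Local Open Scope ring_scope.

(* The norms of MathComp satisfy `|x *+ n| = `|x| *+ n, which excludes
   ultrametric absolute values. *)
HB.mixin Record Field_hasUltrametric (R : realType) K of GRing.Field K := {
  vabs : K -> R;
  vabs_ge0 : forall x, 0 <= vabs x;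
  vabs_eq0 : forall x, (vabs x == 0) = (x == 0);
  vabsM : forall x y, vabs (x * y) = vabs x * vabs y;
  vabsD_max : forall x y, vabs (x + y) <= Num.max (vabs x) (vabs y)
}.

#[short(type="ultrametricFieldType")]
HB.structure Definition UltrametricField (R : realType) :=
  {K of GRing.Field K & Field_hasUltrametric R K}.

Section Ultrametric.
Context {R : realType} {K : ultrametricFieldType R}.
Implicit Types (x : K) (u : nat -> K).

Lemma vabs1 : vabs (1 : K) = 1.
Proof.
have n0 : vabs (1 : K) != 0 by rewrite vabs_eq0 oner_eq0.
by apply: (mulfI n0); rewrite -vabsM !mulr1.
Qed.

Lemma vabsN x : vabs (- x) = vabs x.
Proof.
have : vabs (- 1 : K) ^+ 2 = 1 by rewrite expr2 -vabsM mulrNN mulr1 vabs1.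
move/eqP; rewrite sqrf_eq1 => /orP[/eqP E|/eqP E].
  by rewrite -mulN1r vabsM E mul1r.
by have := vabs_ge0 (- 1 : K); rewrite E oppr_ge0 ler10.
Qed.

Definition vcvg {T : Type} (F : set_system T) (f : T -> K) (l : K) : Prop :=
  vabs (f t - l) @[t --> F] --> (0 : R).

(* The limit when there is one, and 0 otherwise. *)
Definition vlim {T : Type} (F : set_system T) (f : T -> K) : K :=
  xget 0 [set l | vcvg F f l].

Lemma vcvg_unique {T : Type} (F : set_system T) {FF : ProperFilter F} f l l' :
  vcvg F f l -> vcvg F f l' -> l = l'.
Proof.
move=> fl fl'; apply/eqP; rewrite -subr_eq0 -vabs_eq0 eq_le vabs_ge0 andbT.
apply/ler_addgt0Pr => e e0; rewrite add0r.
have sm (g : T -> K) : vabs (g t) @[t --> F] --> (0 : R) ->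
    \forall t \near F, vabs (g t) < e.
  move=> /cvgrPdist_lt/(_ _ e0); apply: filterS => t.
  by rewrite sub0r normrN ger0_norm ?vabs_ge0.
have [t [h h']] := filter_ex
  (filterI (sm (fun t => f t - l) fl) (sm (fun t => f t - l') fl')).
have -> : l - l' = (f t - l') - (f t - l) by rewrite opprB [RHS]addrC addrA subrK.
by rewrite (le_trans (vabsD_max _ _)) // vabsN ge_max !ltW.
Qed.

Lemma vlimP {T : Type} (F : set_system T) {FF : ProperFilter F} f l :
  vcvg F f l -> vlim F f = l.
Proof.
move=> fl; rewrite /vlim; case: xgetP => [l' _ /= fl'|/(_ l)//].
exact: vcvg_unique fl' fl.
Qed.

Definition vcauchy u : Prop :=
  forall e : R, 0 < e ->
  exists N, forall m n, (N <= m)%N -> (N <= n)%N -> vabs (u m - u n) < e.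

Definition vcomplete : Prop := forall u, vcauchy u -> exists l, vcvg \oo u l.

(* (K, i) is a completion of the field F for the absolute value absF. *)
Definition is_completion (F : fieldType) (absF : F -> R)
    (i : {rmorphism F -> K}) : Prop :=
  [/\ forall a, vabs (i a) = absF a,
      forall x (e : R), 0 < e -> exists a, vabs (x - i a) < e
    & vcomplete].

Definition vball1 : {pred K} := fun x => vabs x <= 1.

Lemma vball1_subring : subring_closed vball1.
Proof.
split=> [|x y|x y]; rewrite /vball1 !unfold_in ?vabs1 // => hx hy.
  by rewrite (le_trans (vabsD_max _ _)) // vabsN ge_max hx.
by rewrite vabsM mulr_ile1 ?vabs_ge0.
Qed.

HB.instance Definition _ :=
  GRing.isSubringClosed.Build K vball1 vball1_subring.

Record vring : predArgType := VRing { vring_val :> K; _ : vring_val \in vball1 }.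

HB.instance Definition _ := [isSub for vring_val].
HB.instance Definition _ := [Choice of vring by <:].
HB.instance Definition _ := [SubChoice_isSubComNzRing of vring by <:].

End Ultrametric.
Arguments vcomplete {R} K.
Arguments vring {R} K.

(* |p|_p = 1/p; numq a and denq a are coprime. *)
Definition padic_abs (R : realType) (p : nat) (a : rat) : R :=
  if a == 0 then 0
  else p%:R ^+ logn p `|denq a|%N / p%:R ^+ logn p `|numq a|%N.

(* Q_p, an algebraic closure of Q_p and C_p, each determined up to isometric
   isomorphism: Q_p is the completion of Q for the p-adic absolute value, the
   absolute value of the algebraic closure extends that of Q_p, and C_p is the
   completion of the algebraic closure. *)
Record padicSystem (R : realType) (p : nat) := PadicSystem {
  Q_p : ultrametricFieldType R;
  Qp_of_rat : {rmorphism rat -> Q_p};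
  Qp_completion : is_completion (@padic_abs R p) Qp_of_rat;
  Qpbar : ultrametricFieldType R;
  Qpbar_of_Qp : {rmorphism Q_p -> Qpbar};
  Qpbar_closed : GRing.closed_field_axiom Qpbar;
  Qpbar_algebraic : forall x : Qpbar, algebraicOver Qpbar_of_Qp x;
  Qpbar_abs : forall a : Q_p, vabs (Qpbar_of_Qp a) = vabs a;
  C_p : ultrametricFieldType R;
  Cp_of_Qpbar : {rmorphism Qpbar -> C_p};
  Cp_completion : is_completion (@vabs R Qpbar) Cp_of_Qpbar
}.

Notation Z_p S := (vring (Q_p S)).

Section Euler.
Context {R : realType} {p : nat} {S : padicSystem R p}.
Local Notation Zp := (Z_p S).
Local Notation Cp := (C_p S).
Implicit Types (q : Cp) (z a : Zp).

(* The filter of natural numbers converging p-adically to z. *)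
Definition nat_nbhs z : set_system nat :=
  filter_from [set e : R | 0 < e]
    (fun e => [set m : nat | vabs (vring_val (m%:R - z)) < e]).

(* q ^ z for |1 - q| < 1: the continuous extension of m |-> q ^+ m from the
   natural numbers to Z_p. *)
Definition qpow q z : Cp := vlim (nat_nbhs z) (fun m => q ^+ m).

Definition qnum q z : Cp := (1 - qpow q z) / (1 - q).

(* [a / w] in base q ^ w; a / w need not be a p-adic integer. *)
Definition qnum_frac q (w : nat) a : Cp := (1 - qpow q a) / (1 - q ^+ w).

Definition fermionic_int (f : Zp -> Cp) : Cp :=
  vlim \oo (fun N : nat => \sum_(y < p ^ N) f y%:R * (-1) ^+ y).

(* The innermost integral is over the first coordinate. *)
Fixpoint fermionic_mint (r : nat) : (r.-tuple Zp -> Cp) -> Cp :=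
  match r with
  | 0 => fun f => f [tuple]
  | r'.+1 => fun f =>
      fermionic_int (fun y => fermionic_mint (fun s => f [tuple of rcons s y]))
  end.

Definition qEuler (r n : nat) q z : Cp :=
  fermionic_mint (fun y : r.-tuple Zp =>
    qnum q (z + \sum_(l < r) tnth y l) ^+ n).

(* E^(r)_{n, q ^ w} (a / w), through
   a / w + y_1 + .. + y_r = (a + w (y_1 + .. + y_r)) / w. *)
Definition qEuler_frac (r n : nat) q (w : nat) a : Cp :=
  fermionic_mint (fun y : r.-tuple Zp =>
    qnum_frac q w (a + w%:R * \sum_(l < r) tnth y l) ^+ n).

Lemma qEuler_frac1 r n q z : qEuler_frac r n q 1 z = qEuler r n q z.
Proof.
rewrite /qEuler_frac /qEuler; congr fermionic_mint.
by apply/funext => y; rewrite /qnum_frac expr1 mul1r.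
Qed.

End Euler.

(* Main.v *)
(* By the binomial formula [z]_q^n is a linear combination of the characters
   z |-> (q^k)^z, so everything reduces to the one-dimensional integrals
   int Q^y dmu_{-1}(y), limits of geometric sums equal to 2 / (1 + Q) for p odd
   and to 0 for p = 2. Summing over the j_l turns the r-th power of
   2 / (1 + q^(k w1)) into that of
   2 (1 + q^(k w1 w2)) / ((1 + q^(k w1)) (1 + q^(k w2))), symmetric in w1, w2. *)
Require Import Defs.
From mathcomp Require Import all_boot all_order all_algebra.
From mathcomp Require Import all_classical all_reals topology normedtype sequences.
From mathcomp Require Import ring.

Set Implicit Arguments.
Unset Strict Implicit.
Unset Printing Implicit Defensive.

Import Order.TTheory GRing.Theory Num.Theory.
Import numFieldNormedType.Exports.
Local Open Scope classical_set_scope.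
Local Open Scope ring_scope.

Lemma exists_expr_lt {R : realType} (rho e : R) : 0 <= rho < 1 -> 0 < e ->
  exists N, rho ^+ N < e.
Proof.
move=> /andP[rho0 rho1] e0.
have /cvgrPdist_lt/(_ _ e0) [N _ hN] : GRing.exp rho @ \oo --> (0 : R).
  by apply: cvg_expr; rewrite ger0_norm.
by exists N; have := hN N (leqnn N); rewrite /= sub0r normrN ger0_norm ?exprn_ge0.
Qed.

(** * Ultrametric estimates near 1 and limits of sequences *)

Section UltrametricField.
Context {R : realType} {K : ultrametricFieldType R}.
Implicit Types (u v Q : K).

Lemma vabs0 : vabs (0 : K) = 0.
Proof. by apply/eqP; rewrite vabs_eq0. Qed.

Lemma vabsB_max u v : vabs (u - v) <= Num.max (vabs u) (vabs v).
Proof. by rewrite (le_trans (vabsD_max _ _)) // vabsN. Qed.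

Lemma vabsX u n : vabs (u ^+ n) = vabs u ^+ n.
Proof. by elim: n => [|n IH]; rewrite ?expr0 ?vabs1 // !exprS vabsM IH. Qed.

Lemma vabs_natr_le1 n : vabs (n%:R : K) <= 1.
Proof.
elim: n => [|n IH]; first by rewrite vabs0 ler01.
by rewrite -natr1 (le_trans (vabsD_max _ _)) // ge_max IH vabs1 lexx.
Qed.

Lemma vabs_intr_le1 (z : int) : vabs (z%:~R : K) <= 1.
Proof. by case: z => n; rewrite ?NegzE ?mulrNz ?vabsN; exact: vabs_natr_le1. Qed.

Lemma vabs_lt1D u v : vabs u < 1 -> vabs v < 1 -> vabs (u + v) < 1.
Proof. by move=> hu hv; rewrite (le_lt_trans (vabsD_max _ _)) // gt_max hu. Qed.

(** If |Q| < 1, then 1 = (1 - Q) + Q would have absolute value below 1. *)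
Lemma vabs_near1 Q : vabs (1 - Q) < 1 -> vabs Q = 1.
Proof.
move=> hQ; apply/eqP; rewrite eq_le; apply/andP; split.
  rewrite -[Q](subKr 1) (le_trans (vabsB_max _ _)) // ge_max vabs1 lexx /=.
  exact: ltW.
rewrite leNgt; apply/negP => Q1.
by have := vabs_lt1D hQ Q1; rewrite subrK vabs1 ltxx.
Qed.

Lemma vabs_1subX Q n : vabs Q <= 1 -> vabs (1 - Q ^+ n) <= vabs (1 - Q).
Proof.
move=> hQ; elim: n => [|n IH]; first by rewrite expr0 subrr vabs0 vabs_ge0.
have -> : 1 - Q ^+ n.+1 = (1 - Q) + Q * (1 - Q ^+ n).
  by rewrite mulrBr mulr1 -exprS addrA subrK.
rewrite (le_trans (vabsD_max _ _)) // ge_max lexx vabsM /=.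
by rewrite (le_trans _ IH) // ler_piMl ?vabs_ge0.
Qed.

(* 1 - Q^p = (1 - Q)(1 + Q + ... + Q^(p-1)), and the second factor is p modulo
   1 - Q. *)
Lemma vabs_1subXp (p : nat) Q : vabs Q <= 1 ->
  vabs (1 - Q ^+ p) <= Num.max (vabs (p%:R : K)) (vabs (1 - Q)) * vabs (1 - Q).
Proof.
move=> hQ.
have -> : 1 - Q ^+ p = (p%:R - \sum_(i < p) (1 - Q ^+ i)) * (1 - Q).
  rewrite sumrB sumr_const card_ord subKr [RHS]mulrC.
  by rewrite -[Q ^+ p]opprK -[1 - Q]opprB mulNr -subrX1 opprB opprK.
rewrite vabsM ler_wpM2r ?vabs_ge0 // (le_trans (vabsB_max _ _)) //.
rewrite ge_max !le_max lexx /=; apply/orP; right.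
elim/big_ind: _ => [|u v hu hv|i _]; first by rewrite vabs0 vabs_ge0.
  by rewrite (le_trans (vabsD_max _ _)) // ge_max hu.
exact: vabs_1subX.
Qed.

Lemma vring_val_natrB m (z : vring K) :
  vring_val (m%:R - z) = m%:R - vring_val z.
Proof. by rewrite -[LHS]/(val (m%:R - z)) rmorphB rmorph_nat. Qed.

(** A real majorant transfers the limit theorems of the reals to [vcvg]. *)
Lemma vcvg_le (f : nat -> K) l (g : nat -> R) :
  (forall n, vabs (f n - l) <= g n) -> g @ \oo --> (0 : R) -> vcvg \oo f l.
Proof.
move=> fg g0; apply: (squeeze_cvgr _ (cvg_cst 0) g0).
by apply: nearW => n /=; rewrite vabs_ge0 fg.
Qed.

Lemma vcvgZ (f : nat -> K) l c : vcvg \oo f l -> vcvg \oo (fun n => c * f n) (c * l).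
Proof.
move=> fl; apply: (@vcvg_le _ _ (fun n => vabs c * vabs (f n - l))) => [n|].
  by rewrite -mulrBr vabsM.
by rewrite -[X in _ --> X](mulr0 (vabs c)); apply: cvgMr.
Qed.

Lemma vcvgD (f g : nat -> K) l l' : vcvg \oo f l -> vcvg \oo g l' ->
  vcvg \oo (fun n => f n + g n) (l + l').
Proof.
move=> fl gl.
apply: (@vcvg_le _ _ (fun n => vabs (f n - l) + vabs (g n - l'))) => [n|].
  by rewrite opprD addrACA (le_trans (vabsD_max _ _)) // ge_max lerDl lerDr !vabs_ge0.
by rewrite -[X in _ --> X](addr0 0); apply: cvgD.
Qed.

Lemma vcvg_sum (I : Type) (s : seq I) (f : I -> nat -> K) (l : I -> K) :
  (forall i, vcvg \oo (f i) (l i)) ->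
  vcvg \oo (fun n => \sum_(i <- s) f i n) (\sum_(i <- s) l i).
Proof.
move=> fl; elim: s => [|i s IH].
  apply: (@vcvg_le _ _ (fun=> 0)) => [n|]; last exact: cvg_cst.
  by rewrite !big_nil subrr vabs0.
rewrite big_cons; under eq_fun do rewrite big_cons.
exact: vcvgD.
Qed.

Lemma vabs_sub_small_eq u v : (forall e : R, 0 < e -> vabs (u - v) < e) -> u = v.
Proof.
move=> uv; apply/eqP; rewrite -subr_eq0 -vabs_eq0 eq_le vabs_ge0 andbT.
by apply/ler_addgt0Pr => e e0; rewrite add0r ltW ?uv.
Qed.

(** * Consequences of |p| < 1 *)

Section ResidueChar.
Context {p : nat}.
Hypothesis p_lt1 : vabs (p%:R : K) < 1.

(** Take rho = max(|p|, |1 - Q|). Raising to the p-th power multiplies the distance to 1 by at most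
    max(|p|, |1 - Q^(p^N)|), which never exceeds rho. *)
Lemma vabs_1subXpn Q : vabs (1 - Q) < 1 -> exists2 rho : R, 0 <= rho < 1 &
  forall N, vabs (1 - Q ^+ (p ^ N)) <= rho ^+ N.
Proof.
move=> hQ; pose rho := Num.max (vabs (p%:R : K)) (vabs (1 - Q)).
have rho0 : 0 <= rho by rewrite /rho le_max vabs_ge0.
exists rho; first by rewrite rho0 gt_max p_lt1.
move=> N; elim: N => [|N IH]; first by rewrite expn0 expr0 expr1 ltW.
have vQ : vabs (Q ^+ (p ^ N)) <= 1 by rewrite vabsX vabs_near1 ?expr1n.
rewrite expnSr exprM exprS (le_trans (vabs_1subXp _ vQ)) //.
apply: ler_pM; rewrite ?vabs_ge0 ?le_max ?vabs_ge0 //.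
by rewrite -le_max ge_max !le_max lexx vabs_1subX ?orbT // vabs_near1.
Qed.

Lemma vcvg_Xpn Q : vabs (1 - Q) < 1 -> vcvg \oo (fun N => Q ^+ (p ^ N)) 1.
Proof.
move=> /vabs_1subXpn [rho /andP[rho0 rho1] hrho].
apply: (@vcvg_le _ _ (fun N => rho ^+ N)) => [N|]; first by rewrite -vabsN opprB.
by apply: cvg_expr; rewrite ger0_norm.
Qed.

(** For p odd, 1 = p - 2 (p-1)/2, so |2| < 1 together with |p| < 1 would give |1| < 1. *)
Lemma vabs2_odd : odd p -> vabs (2%:R : K) = 1.
Proof.
move=> podd; apply/eqP; rewrite eq_le vabs_natr_le1 leNgt; apply/negP => h2.
have : vabs (p%:R - 2%:R * (p./2)%:R : K) < 1.
  apply: vabs_lt1D => //; rewrite vabsN vabsM.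
  by rewrite (le_lt_trans _ h2) // ler_piMr ?vabs_ge0 ?vabs_natr_le1.
by rewrite -natrM mul2n -{1}(odd_double_half p) podd natrD addrK vabs1 ltxx.
Qed.

(** At Q = -1 the difference 1 - Q is 2, a unit of absolute value 1. *)
Lemma one_add_neq0 Q : odd p -> vabs (1 - Q) < 1 -> 1 + Q != 0.
Proof.
move=> podd hQ; apply/eqP => Q0; move: hQ.
by rewrite (_ : 1 - Q = 2%:R) ?vabs2_odd ?ltxx // -[LHS]addr0 -Q0 addrACA addNr addr0.
Qed.

End ResidueChar.
End UltrametricField.

(** A geometric sum of ratio -Q, where (-Q)^w = - Q^w because w is odd. *)
Lemma sum_altr_geom {F : fieldType} (Q : F) (w : nat) : odd w -> 1 + Q != 0 ->
  \sum_(j < w) (-1) ^+ j * Q ^+ j = (1 + Q ^+ w) / (1 + Q).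
Proof.
move=> w_odd Q0; apply: (mulIf Q0); rewrite divfK //.
under eq_bigr do rewrite -exprMn mulN1r.
rewrite -[1 + Q in LHS]opprK opprD mulrN mulrC [- 1 - Q]addrC -subrX1 opprB.
by rewrite exprNn -signr_odd w_odd expr1 mulN1r opprK.
Qed.

(** * The p-adic absolute value and the density of the naturals in Z_p *)

Section PadicSystem.
Context {R : realType} {p : nat} {S : padicSystem R p}.
Hypothesis p_prime : prime p.
Local Notation Qp := (Q_p S).
Local Notation Cp := (C_p S).

Lemma vabs_Qp_natr n : (0 < n)%N -> vabs (n%:R : Qp) = (p%:R ^+ logn p n)^-1.
Proof.
move=> n0; have [iso _ _] := Qp_completion S.
rewrite -(rmorph_nat (Qp_of_rat S)) iso /padic_abs pnatr_eq0 gtn_eqF //.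
by rewrite [n%:R]pmulrn numq_int denq_int /= logn1 expr0 div1r.
Qed.

Lemma vabs_Cp_natr n : vabs (n%:R : Cp) = vabs (n%:R : Qp).
Proof.
have [iso _ _] := Cp_completion S.
by rewrite -(rmorph_nat (Cp_of_Qpbar S)) iso -(rmorph_nat (Qpbar_of_Qp S)) Qpbar_abs.
Qed.

Lemma vabs_Qp_p_lt1 : vabs (p%:R : Qp) < 1.
Proof.
rewrite vabs_Qp_natr ?prime_gt0 // logn_prime // eqxx expr1.
by rewrite invf_lt1 ?ltr0n ?ltr1n ?prime_gt0 ?prime_gt1.
Qed.

Lemma vabs_Cp_p_lt1 : vabs (p%:R : Cp) < 1.
Proof. by rewrite vabs_Cp_natr vabs_Qp_p_lt1. Qed.

Lemma dvdn_of_vabs_le N s :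
  vabs (s%:R : Qp) <= vabs (p%:R : Qp) ^+ N -> (p ^ N %| s)%N.
Proof.
have [->|s0] := posnP s; first by rewrite dvdn0.
rewrite -vabsX -natrX !vabs_Qp_natr ?s0 ?expn_gt0 ?(prime_gt0 p_prime) ?pfactorK //.
have pp n : (p%:R ^+ n : R) \is Num.pos.
  by rewrite posrE exprn_gt0 // ltr0n prime_gt0.
rewrite lef_pV2 // ler_eXn2l ?ltr1n ?prime_gt1 // => h.
by rewrite pfactor_dvdn.
Qed.

(** A rational [a] close to z is p-integral, so its denominator is invertible modulo p^N; reducing
    numerator times inverse modulo p^N yields a natural number close to [a]. *)
Lemma Zp_nat_dense (z : Z_p S) (e : R) : 0 < e ->
  exists m : nat, vabs (m%:R - vring_val z) < e.
Proof.
move=> e0; have [iso dense _] := Qp_completion S.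
(* The bound 1 on the distance forces |a| <= 1, since |z| <= 1. *)
have e1 : 0 < Num.min e 1 by rewrite lt_min e0 ltr01.
have [a] := dense (vring_val z) _ e1; rewrite lt_min => /andP[ae a1].
have ia : Qp_of_rat S a = (numq a)%:~R / (denq a)%:~R.
  by rewrite -{1}(divq_num_den a) fmorph_div !rmorph_int.
have d0 : (denq a)%:~R != 0 :> Qp.
  by rewrite -(rmorph_int (Qp_of_rat S)) fmorph_eq0 intr_eq0 denq_neq0.
have a_le1 : vabs (Qp_of_rat S a) <= 1.
  rewrite -(subKr (vring_val z) (Qp_of_rat S a)) (le_trans (vabsB_max _ _)) //.
  by rewrite ge_max (ltW a1) andbT; case: (z).
(* By Bezout, 1 is an integral combination of numerator and denominator; since |a| <= 1, both terms
   are bounded by the absolute value of the denominator. *)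
have den1 : vabs ((denq a)%:~R : Qp) = 1.
  apply/eqP; rewrite eq_le vabs_intr_le1 /=.
  have [[u v] /= uv] := coprimezP _ _ (coprime_num_den a).
  have -> : 1 = vabs (u%:~R * (numq a)%:~R + v%:~R * (denq a)%:~R : Qp).
    by rewrite -!intrM -intrD uv vabs1.
  rewrite (le_trans (vabsD_max _ _)) // !vabsM ge_max; apply/andP; split.
    have -> : (numq a)%:~R = Qp_of_rat S a * (denq a)%:~R by rewrite ia divfK.
    rewrite vabsM mulrA ler_piMl ?vabs_ge0 // mulr_ile1 ?vabs_ge0 //.
    exact: vabs_intr_le1.
  by rewrite ler_piMl ?vabs_ge0 // vabs_intr_le1.
have [N hN] : exists N, vabs (p%:R : Qp) ^+ N < e.
  by apply: exists_expr_lt => //; rewrite vabs_ge0 vabs_Qp_p_lt1.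
have cop : coprimez (p ^ N)%N%:Z (denq a).
  rewrite /coprimez /gcdz /= -[_ == _]/(coprime (p ^ N) `|denq a|).
  apply: coprimeXl; rewrite prime_coprime //; apply/negP => /dvdnP[k hk].
  move: vabs_Qp_p_lt1; rewrite ltNge -{1}den1 => /negP; apply.
  rewrite -absz_denq hk -pmulrn natrM vabsM ler_piMl ?vabs_ge0 //.
  exact: vabs_natr_le1.
(* [t] inverts the denominator modulo p^N; the witness [m] is the residue of [t * numq a]. *)
have [[s t] /= st] := coprimezP _ _ cop.
have pN0 : (p ^ N)%N%:Z != 0 by rewrite eqz_nat -lt0n expn_gt0 prime_gt0.
have := divz_eq (t * numq a) (p ^ N)%N%:Z.
have := modz_ge0 (t * numq a) pN0.
case: (_ %% _)%Z => // m _; set k := (_ %/ _)%Z => hk.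
exists m; have -> : m%:R - vring_val z = (m%:R - Qp_of_rat S a) -
    (vring_val z - Qp_of_rat S a).
  by rewrite opprB addrA subrK.
rewrite (le_lt_trans (vabsB_max _ _)) // gt_max ae andbT.
(* Multiplying by the denominator keeps the absolute value and leaves an integer, divisible by
   p^N. *)
rewrite (le_lt_trans _ hN) // -[leLHS]mulr1 -den1 -vabsM mulrBl ia divfK //.
have E : m%:Z * denq a - numq a = - ((p ^ N)%N%:Z * (numq a * s + k * denq a)).
  have -> : m%:Z = t * numq a - k * (p ^ N)%N%:Z by rewrite hk addrAC subrr add0r.
  by rewrite -[X in _ - X]mul1r -st; ring.
have -> : m%:R * (denq a)%:~R - (numq a)%:~R =
    - (p%:R ^+ N * (numq a * s + k * denq a)%:~R) :> Qp.
  rewrite -natrX; move/(congr1 (intr : int -> Qp)): E.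
  by rewrite rmorphB rmorphN !rmorphM.
rewrite vabsN vabsM vabsX ler_piMr ?exprn_ge0 ?vabs_ge0 //.
exact: vabs_intr_le1.
Qed.

(** Properness is the density of the naturals; it makes limits along [nat_nbhs z] unique. *)
#[local] Instance nat_nbhs_filter (z : Z_p S) : ProperFilter (nat_nbhs z).
Proof.
apply: filter_from_proper; last first.
  move=> e /= e0; have [m hm] := Zp_nat_dense z e0.
  by rewrite -vring_val_natrB in hm; exists m.
apply: filter_from_filter; first by exists 1; rewrite /= ltr01.
move=> d e /= d0 e0; exists (Num.min d e); first by rewrite /= lt_min d0.
by move=> m /=; rewrite lt_min => /andP[].
Qed.

Lemma near_nat_nbhsE (z : Z_p S) (P : nat -> Prop) :
  (\forall m \near nat_nbhs z, P m) <->
  exists2 d : R, 0 < d & forall m, vabs (m%:R - vring_val z) < d -> P m.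
Proof.
split=> -[d d0 hd]; exists d => // m hm; apply: hd.
  by rewrite -vring_val_natrB in hm.
by rewrite -vring_val_natrB; exact: hm.
Qed.

(** * The power q^z as a continuous character of Z_p *)

Section Power.
Variable q : Cp.
Hypothesis q_near1 : vabs (1 - q) < 1.

(** For d = |p|^N, closeness of m and k means m = k + s p^N, and then q^m - q^k is a multiple of 1 -
    q^(p^N) by a factor of absolute value at most 1. *)
Lemma expr_unif_continuous (e : R) : 0 < e -> exists2 d : R, 0 < d &
  forall m k, vabs (m%:R - k%:R : Qp) < d -> vabs (q ^+ m - q ^+ k) < e.
Proof.
move=> e0; have [rho rho01 hrho] := vabs_1subXpn vabs_Cp_p_lt1 q_near1.
have [N hN] := exists_expr_lt rho01 e0.
exists (vabs (p%:R : Qp) ^+ N).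
  by rewrite exprn_gt0 // vabs_Qp_natr ?prime_gt0 // invr_gt0 exprn_gt0 // ltr0n
    prime_gt0.
move=> m k; wlog km : m k / (k <= m)%N => [wl|].
  have [km|mk] := leqP k m; first exact: wl.
  rewrite -vabsN opprB => mk'; rewrite -vabsN opprB; apply: wl => //.
  exact: ltnW.
rewrite -natrB // => /ltW/dvdn_of_vabs_le/dvdnP[s ms].
have -> : q ^+ m - q ^+ k = - (q ^+ k * (1 - (q ^+ (p ^ N)) ^+ s)).
  by rewrite -exprM mulnC -ms mulrBr mulr1 -exprD subnKC // opprB.
rewrite vabsN vabsM vabsX vabs_near1 // expr1n mul1r (le_lt_trans _ hN) //.
by rewrite (le_trans (vabs_1subX _ _)) // vabsX vabs_near1 // expr1n.
Qed.

(** The point is that the limit defining [qpow] exists, so that [vlim] does not fall back to 0: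
    along naturals [u i] tending to z, the powers of q are Cauchy by uniform continuity, and C_p is
    complete. *)
Lemma qpow_continuous (z : Z_p S) (e : R) : 0 < e -> exists2 d : R, 0 < d &
  forall m, vabs (m%:R - vring_val z) < d -> vabs (q ^+ m - qpow q z) < e.
Proof.
suff [l hl] : exists l, vcvg (nat_nbhs z) (fun m => q ^+ m) l.
  rewrite /qpow (vlimP hl) => e0.
  have /cvgrPdist_lt/(_ _ e0)/near_nat_nbhsE[d d0 hd] := hl.
  exists d => // m /hd.
  by rewrite sub0r normrN ger0_norm ?vabs_ge0.
have pos i : 0 < i.+1%:R^-1 :> R by rewrite invr_gt0 ltr0n.
have [u hu] := choice (fun i => Zp_nat_dense z (pos i)).
have small d : 0 < d ->
    exists N, forall i, (N <= i)%N -> vabs ((u i)%:R - vring_val z) < d.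
  move=> d0; have /cvgrPdist_lt/(_ _ d0) [N _ hN] := @cvg_harmonic R.
  exists N => i Ni; apply: lt_trans (hu i) _.
  by have := hN i Ni; rewrite /= sub0r normrN ger0_norm // invr_ge0 ler0n.
have close m k d : vabs (m%:R - vring_val z) < d ->
    vabs (k%:R - vring_val z) < d -> vabs (m%:R - k%:R : Qp) < d.
  move=> md kd; have -> : m%:R - k%:R = (m%:R - vring_val z) - (k%:R - vring_val z).
    by rewrite opprB addrA subrK.
  by rewrite (le_lt_trans (vabsB_max _ _)) // gt_max md.
have [_ _ complete] := Cp_completion S.
have [|l hl] := complete (fun i => q ^+ u i).
  move=> e' /expr_unif_continuous[d d0 hd]; have [N hN] := small d d0.
  by exists N => i j Ni Nj; apply/hd/close; apply: hN.
exists l; apply/cvgrPdist_lt => e' e0'; apply/near_nat_nbhsE.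
have [d d0 hd] := expr_unif_continuous e0'; have [N hN] := small d d0.
have /cvgrPdist_lt/(_ _ e0') [M _ hM] := hl.
exists d => // m md.
rewrite sub0r normrN ger0_norm ?vabs_ge0 //.
pose i := maxn N M.
have -> : q ^+ m - l = (q ^+ m - q ^+ u i) + (q ^+ u i - l) by rewrite addrA subrK.
rewrite (le_lt_trans (vabsD_max _ _)) // gt_max hd /=.
  by have := hM i (leq_maxr _ _); rewrite /= sub0r normrN ger0_norm ?vabs_ge0.
by apply: close => //; apply: hN; exact: leq_maxl.
Qed.

Lemma qpow_natr m : qpow q (m%:R : Z_p S) = q ^+ m.
Proof.
apply: vabs_sub_small_eq => e e0; rewrite -vabsN opprB.
have [d d0] := qpow_continuous m%:R e0; apply.
by rewrite -vring_val_natrB subrr vabs0.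
Qed.

Lemma vabs_qpow_le1 (z : Z_p S) : vabs (qpow q z) <= 1.
Proof.
have [d d0 hd] := qpow_continuous z ltr01; have [m /hd hm] := Zp_nat_dense z d0.
rewrite -(subKr (q ^+ m) (qpow q z)) (le_trans (vabsB_max _ _)) // ge_max (ltW hm).
by rewrite vabsX vabs_near1 // expr1n lexx.
Qed.

Lemma qpowD (a b : Z_p S) : qpow q (a + b) = qpow q a * qpow q b.
Proof.
apply: vabs_sub_small_eq => e e0.
have [da da0 ha] := qpow_continuous a e0.
have [db db0 hb] := qpow_continuous b e0.
have [dc dc0 hc] := qpow_continuous (a + b) e0.
(* The extra bound [dc] on both approximations puts [m + k] within [dc] of [a + b], by the
   ultrametric inequality. *)
have da' : 0 < Num.min da dc by rewrite lt_min da0.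
have db' : 0 < Num.min db dc by rewrite lt_min db0.
have [m] := Zp_nat_dense a da'; rewrite lt_min => /andP[ma mc].
have [k] := Zp_nat_dense b db'; rewrite lt_min => /andP[kb kc].
have -> : qpow q (a + b) - qpow q a * qpow q b =
    (q ^+ m * (q ^+ k - qpow q b) + (q ^+ m - qpow q a) * qpow q b) -
    (q ^+ (m + k) - qpow q (a + b)) by rewrite exprD; ring.
rewrite (le_lt_trans (vabsB_max _ _)) // gt_max; apply/andP; split.
  rewrite (le_lt_trans (vabsD_max _ _)) // gt_max; apply/andP; split.
    by rewrite vabsM vabsX vabs_near1 // expr1n mul1r hb.
  rewrite vabsM (le_lt_trans _ (ha m ma)) // ler_piMr ?vabs_ge0 //.
  exact: vabs_qpow_le1.
apply: hc; rewrite natrD -[vring_val (a + b)]/(vring_val a + vring_val b).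
by rewrite opprD addrACA (le_lt_trans (vabsD_max _ _)) // gt_max mc.
Qed.

Lemma qpow_natM w (z : Z_p S) : qpow q (w%:R * z) = qpow q z ^+ w.
Proof.
elim: w => [|w IH]; first by rewrite mul0r expr0 (qpow_natr 0).
by rewrite -natr1 mulrDl mul1r qpowD IH exprSr.
Qed.

End Power.

(** * Fermionic integrals of characters *)

Definition fermionic_geom (Q : Cp) : Cp := if odd p then 2%:R / (1 + Q) else 0.

(** The partial sums are (1 - (-Q)^(p^N)) / (1 + Q). For p odd, (-Q)^(p^N) = - Q^(p^N) tends to -1.
    For p = 2, -Q is itself near 1, so the numerator tends to 0. *)
Lemma vcvg_fermionic_geom (Q : Cp) : vabs (1 - Q) < 1 ->
  vcvg \oo (fun N : nat => \sum_(y < p ^ N) Q ^+ y * (-1) ^+ y) (fermionic_geom Q).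
Proof.
move=> hQ; rewrite /fermionic_geom.
have geomE N : 1 + Q != 0 ->
    \sum_(y < p ^ N) Q ^+ y * (-1) ^+ y = (1 + Q)^-1 * (1 - (- Q) ^+ (p ^ N)).
  move=> Q0; apply: (mulfI Q0); rewrite mulVKf //.
  rewrite -[1 - _ in RHS]opprB subrX1 -mulNr opprB opprK; congr (_ * _).
  by apply: eq_bigr => y _; rewrite mulrC -exprMn mulN1r.
have cst (c : Cp) : vcvg \oo (fun=> c) c.
  by apply: vcvg_le (cvg_cst 0) => N; rewrite subrr vabs0.
have limX := vcvg_Xpn vabs_Cp_p_lt1.
have [p2|podd] := even_prime p_prime; last first.
  have Q0 := one_add_neq0 vabs_Cp_p_lt1 podd hQ.
  rewrite podd mulrC; under eq_fun do rewrite geomE //.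
  apply: vcvgZ; rewrite -[2%:R]/(1 + 1).
  under eq_fun => N do rewrite exprNn -signr_odd oddX podd orbT expr1 mulN1r opprK.
  exact: vcvgD (cst 1) (limX _ hQ).
have /negbTE -> : ~~ odd p by rewrite p2.
(* For p = 2 the value Q = -1 is possible: all terms are then 1 and the sum is 2^N, which tends to
   0. *)
have [Q0|Q0] := eqVneq (1 + Q) 0.
  have -> : Q = -1 by apply/eqP; rewrite -addr_eq0 addrC Q0.
  apply: (@vcvg_le _ _ _ _ (fun N => vabs (p%:R : Cp) ^+ N)) => [N|].
    rewrite subr0 (eq_bigr (fun=> 1)) => [|y _].
      by rewrite sumr_const card_ord natrX vabsX.
    by rewrite -exprMn mulrNN mulr1 expr1n.
  by apply: cvg_expr; rewrite ger0_norm ?vabs_ge0 ?vabs_Cp_p_lt1.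
under eq_fun do rewrite geomE //.
have hNQ : vabs (1 - - Q) < 1.
  have -> : 1 - - Q = p%:R - (1 - Q).
    have -> : p%:R = 1 + 1 :> Cp by exact: (congr1 (fun m => m%:R) p2).
    by rewrite opprK opprB addrCA addrC addrK addrC.
  by apply: vabs_lt1D; rewrite ?vabsN ?vabs_Cp_p_lt1.
have -> : 0 = (1 + Q)^-1 * (1 + -1 * 1) :> Cp by rewrite mulr1 subrr mulr0.
apply: vcvgZ; under eq_fun do rewrite -mulN1r.
exact: vcvgD (cst 1) (vcvgZ _ (limX _ hNQ)).
Qed.

(** Linearity is stated for convergent integrals, because [vlim] gives 0 on divergent ones. *)
Lemma fermionic_int_sum (m : nat) (c e : 'I_m -> Cp) (f : 'I_m -> Z_p S -> Cp) :
  (forall k, vcvg \oo (fun N : nat => \sum_(y < p ^ N) f k y%:R * (-1) ^+ y) (e k)) ->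
  fermionic_int (fun y => \sum_k c k * f k y) = \sum_k c k * e k.
Proof.
move=> fe; apply: vlimP.
under eq_fun => N do under eq_bigr do rewrite mulr_suml.
under eq_fun => N do rewrite exchange_big.
apply: vcvg_sum => k; under eq_fun do (under eq_bigr do rewrite -mulrA).
by under eq_fun do rewrite -mulr_sumr; exact: vcvgZ.
Qed.

(** A character of a sum splits into a product, so the iterated integral is an r-th power. The
    induction peels off the last coordinate y and absorbs [chi k y] into the coefficients, which
    must therefore stay general. *)
Lemma fermionic_mint_char (m r : nat) (c e : 'I_m -> Cp) (chi : 'I_m -> Z_p S -> Cp) :
  (forall k, chi k 0 = 1) ->
  (forall k y z, chi k (y + z) = chi k y * chi k z) ->
  (forall k, vcvg \oo (fun N : nat => \sum_(y < p ^ N) chi k y%:R * (-1) ^+ y) (e k)) ->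
  fermionic_mint
    (fun y : r.-tuple (Z_p S) => \sum_k c k * chi k (\sum_(l < r) tnth y l))
  = \sum_k c k * e k ^+ r.
Proof.
move=> chi0 chiD chie; elim: r c => [|r IH] c /=.
  by apply: eq_bigr => k _; rewrite big_ord0 chi0.
transitivity (fermionic_int (fun y => \sum_k (c k * e k ^+ r) * chi k y)); last first.
  by rewrite (fermionic_int_sum _ chie); apply: eq_bigr => k _; rewrite exprSr mulrA.
congr fermionic_int; apply/funext => y.
transitivity (\sum_k (c k * chi k y) * e k ^+ r); last first.
  by apply: eq_bigr => k _; rewrite mulrAC.
rewrite -IH; congr fermionic_mint; apply/funext => s.
apply: eq_bigr => k _; rewrite -mulrA -chiD; congr (_ * chi k _).
(* Sums over indices become sums over sequences, where the last entry can be split off. *)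
rewrite -[LHS](big_tuple _ _ [tuple of rcons s y] xpredT id) /=.
by rewrite -[in RHS](big_tuple _ _ s xpredT id) big_rcons addrC.
Qed.

(** * Closed form of the Euler polynomials and the symmetry *)

Section Symmetry.
Variable q : Cp.
Hypothesis q_near1 : vabs (1 - q) < 1.

Lemma near1X m : vabs (1 - q ^+ m) < 1.
Proof. by rewrite (le_lt_trans (vabs_1subX _ _)) // vabs_near1. Qed.

(** Binomial expansion of the n-th power; the k-th term carries the character z |-> q^(w k z), whose
    integral is [fermionic_geom (q ^+ (w * k))]. *)
Lemma qEuler_fracE (r n w : nat) (a : Z_p S) :
  qEuler_frac r n q w a = \sum_(k < n.+1)
    (1 - q ^+ w) ^- n * ((-1) ^+ k *+ 'C(n, k)) * qpow q a ^+ k *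
    fermionic_geom (q ^+ (w * k)) ^+ r.
Proof.
rewrite -(@fermionic_mint_char _ _ _ _ (fun k z => qpow q z ^+ (w * k))); first 1 last.
- by move=> k; rewrite (qpow_natr q_near1 0) expr0 expr1n.
- by move=> k y z; rewrite qpowD // exprMn.
- move=> k; have := vcvg_fermionic_geom (near1X (w * k)).
  by under eq_fun do under eq_bigr do rewrite exprAC -(qpow_natr q_near1).
congr fermionic_mint; apply/funext => y.
rewrite /qnum_frac qpowD // qpow_natM // expr_div_n mulrC.
rewrite [(1 - _ * _) ^+ n]exprBn mulr_sumr.
apply: eq_bigr => k _; rewrite expr1n mulr1 exprMn -exprM -mulrnAl.
by rewrite !mulrA.
Qed.

(** The numerator of [w]_q^n cancels (1 - q^w)^(-n), leaving (1 - q)^(-n), which is free of w. The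
    sum over the j_l factors, so w and w' survive only in the base of an r-th power. *)
Lemma weighted_sum_qEuler (r n w w' : nat) (z : Z_p S) : 1 - q ^+ w != 0 ->
  qnum q (w%:R : Z_p S) ^+ n *
    \sum_(j : {ffun 'I_r -> 'I_w}) (-1) ^+ (\sum_(l < r) j l)%N *
      qEuler_frac r n q w (z + w'%:R * (\sum_(l < r) j l)%N%:R)
  = \sum_(k < n.+1) (1 - q) ^- n * ((-1) ^+ k *+ 'C(n, k)) * qpow q z ^+ k *
      ((\sum_(i < w) (-1) ^+ i * (q ^+ (w' * k)) ^+ i) *
       fermionic_geom (q ^+ (w * k))) ^+ r.
Proof.
move=> den0; under eq_bigr do rewrite qEuler_fracE mulr_sumr.
rewrite exchange_big mulr_sumr; apply: eq_bigr => k _ /=.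
rewrite [((\sum_(i < w) _) * _) ^+ r]exprMn mulr_sumr.
(* Distributivity expands a product of r equal sums over all functions j. *)
have -> : (\sum_(i < w) (-1) ^+ i * (q ^+ (w' * k)) ^+ i) ^+ r =
    \sum_(j : {ffun 'I_r -> 'I_w})
      (-1) ^+ (\sum_(l < r) j l)%N * (q ^+ (w' * k)) ^+ (\sum_(l < r) j l)%N.
  rewrite -[in LHS](card_ord r) -prodr_const bigA_distr_bigA /=.
  by apply: eq_bigr => j _; rewrite big_split /= !prodrXr.
rewrite mulr_suml mulr_sumr; apply: eq_bigr => j _.
set J := (\sum_(l < r) j l)%N.
rewrite /qnum qpow_natr // qpowD // qpow_natM // qpow_natr // expr_div_n exprMn.
have -> : (q ^+ J) ^+ w' ^+ k = (q ^+ (w' * k)) ^+ J.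
  by rewrite -!exprM mulnC.
have dn : (1 - q ^+ w) ^+ n != 0 by rewrite expf_neq0.
set B := _ *+ _; set E := _ ^+ r; set X := (q ^+ (w' * k)) ^+ J.
set A := qpow q z ^+ k.
transitivity ((1 - q) ^- n * ((1 - q ^+ w) ^+ n / (1 - q ^+ w) ^+ n) * B * A *
  ((-1) ^+ J * X * E)); last by rewrite divff // mulr1.
by ring.
Qed.

(* With Q = q ^ k, both sides equal
   2 (1 + Q ^ (w w')) / ((1 + Q ^ w) (1 + Q ^ w')) for odd p. *)
Lemma fermionic_geom_sym (w w' k : nat) : odd w -> odd w' ->
  (\sum_(i < w) (-1) ^+ i * (q ^+ (w' * k)) ^+ i) * fermionic_geom (q ^+ (w * k))
  = (\sum_(i < w') (-1) ^+ i * (q ^+ (w * k)) ^+ i) * fermionic_geom (q ^+ (w' * k)).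
Proof.
move=> ow ow'; rewrite /fermionic_geom; case: ifPn => [podd|_]; last by rewrite !mulr0.
have Q0 m : 1 + q ^+ m != 0 by exact: (one_add_neq0 vabs_Cp_p_lt1 podd (near1X m)).
rewrite !sum_altr_geom // -!exprM.
have -> : (w' * k * w = w * k * w')%N by rewrite mulnAC [RHS]mulnAC (mulnC w).
by rewrite mulrACA [RHS]mulrACA [X in _ = _ * X]mulrC.
Qed.

End Symmetry.

End PadicSystem.

Theorem theorem3 (R : realType) (p : nat) (S : padicSystem R p)
    (q : C_p S) (r n : nat) (x : Z_p S) (w1 w2 : nat)
    (p_prime : prime p) (q_near1 : vabs (1 - q) < 1) (r_gt0 : (0 < r)%N)
    (w1_odd : w1 = 1 %[mod 2]) (w2_odd : w2 = 1 %[mod 2])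
    (den1_neq0 : 1 - q ^+ w1 != 0) (den2_neq0 : 1 - q ^+ w2 != 0) :
  qnum q (w1%:R : Z_p S) ^+ n *
    \sum_(j : {ffun 'I_r -> 'I_w1})
      (-1) ^+ (\sum_(l < r) j l)%N *
      qEuler_frac r n q w1
        (w1%:R * w2%:R * x + w2%:R * (\sum_(l < r) j l)%N%:R)
  = qnum q (w2%:R : Z_p S) ^+ n *
    \sum_(j : {ffun 'I_r -> 'I_w2})
      (-1) ^+ (\sum_(l < r) j l)%N *
      qEuler_frac r n q w2
        (w1%:R * w2%:R * x + w1%:R * (\sum_(l < r) j l)%N%:R).
Proof.
have w_odd w : w = 1 %[mod 2] -> odd w by rewrite !modn2; case: odd.
(* Both sides have z = w1 w2 x, so their k-th terms differ only in the base of the r-th power. *)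
rewrite !weighted_sum_qEuler //; apply: eq_bigr => k _.
by rewrite fermionic_geom_sym ?w_odd.
Qed.
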